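(* Let $P(x)=R(x)-q$ be a real polynomial in $x$ of degree $n\ge 2$, with $R(0)=0$ and $q\in\mathbb{R}$. Let $x(q)$ be one of the roots of the equation $P(x)=0$, defined in a neighborhood of $0$, that tends to $0$ as $q$ tends to $0$. Then $x(q)$ satisfies a generalized Abel ODE of degree $n-1$, $$x'=a_{n-1}(q)x^{n-1}+a_{n-2}(q)x^{n-2}+\cdots+a_1(q)x+a_0(q),$$ where $a_j(q)$, $j=0,1,\ldots,n-1$, are rational functions of $q$ with coefficients depending on the coefficients of $R$.
   Context: $R\in\mathbb{R}[x]$ is a polynomial of degree $n$ not depending on $q$. For an integer $m>0$, a generalized Abel ODE of degree $m$ is a non-autonomous first order real ODE of the form $x'=a_m(q)x^m+a_{m-1}(q)x^{m-1}+\cdots+a_1(q)x+a_0(q)$ (the leading coefficient $a_m$ is not required to be nonzero); here $'=\mathrm{d}/\mathrm{d}q$. The root $x(q)$ is a continuous branch of solutions, i.e. a continuous (real- or complex-valued) function of the real variable $q$ near $0$ with $R(x(q))=q$. That $x(q)$ satisfies the ODE means that the equation holds at each $q$ of its domain at which $x$ is differentiable and the coefficients $a_j$ have no pole (a pole at $q=0$ may occur). *)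

(* Defs.v *)
From HB Require Import structures.
From mathcomp Require Import all_boot all_order all_algebra.
From mathcomp Require Import generic_quotient fraction complex.
From mathcomp Require Import all_classical all_reals all_analysis.

Set Implicit Arguments.
Unset Strict Implicit.
Unset Printing Implicit Defensive.

Import Order.TTheory GRing.Theory Num.Theory.
Import numFieldNormedType.Exports.

Local Open Scope classical_set_scope.
Local Open Scope ring_scope.

(* [repr f] is an arbitrary pair representing [f]; the common factors are
   removed so that removable singularities are not counted as poles. *)
Definition ratfun_num (F : fieldType) (f : {fraction {poly F}}) : {poly F} :=
  (repr f).1 %/ gcdp (repr f).1 (repr f).2.

Definition ratfun_den (F : fieldType) (f : {fraction {poly F}}) : {poly F} :=
  (repr f).2 %/ gcdp (repr f).1 (repr f).2.

Definition has_pole (F : fieldType) (f : {fraction {poly F}}) (q : F) : bool :=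
  root (ratfun_den f) q.

Definition ratfun_eval (F : fieldType) (f : {fraction {poly F}}) (q : F) : F :=
  (ratfun_num f).[q] / (ratfun_den f).[q].

Local Open Scope complex_scope.

(* The derivative of a complex-valued function of a real variable: MathComp-
   Analysis has no normed [R]-module structure on [R[i]], so [derive1] does not
   apply to [x]. *)
Definition is_cderive1 (R : realType) (x : R -> (R[i])^o) (q : R)
    (l : (R[i])^o) : Prop :=
  (x (q + h) - x q) / h%:C @[h --> 0^'] --> l.

(* Real-valued branches are the case where [x] takes values in the image of
   [_%:C]. *)
Definition root_branch (R : realType) (P : {poly R}) (U : set R)
    (x : R -> (R[i])^o) : Prop :=
  [/\ open U, U 0, {in U, continuous x} &
      forall q : R, U q -> (map_poly (real_complex R) P).[x q] = q%:C].

Definition satisfies_Abel_ODE (R : realType) (m : nat)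
    (a : 'I_m.+1 -> {fraction {poly R}}) (U : set R)
    (x : R -> (R[i])^o) : Prop :=
  forall (q : R) (l : (R[i])^o), U q ->
    (forall j : 'I_m.+1, ~~ has_pole (a j) q) ->
    is_cderive1 x q l ->
    l = \sum_(j < m.+1) (ratfun_eval (a j) q)%:C * x q ^+ j.

(* Main.v *)
Require Import Defs.
From mathcomp Require Import all_boot all_order all_algebra.
From mathcomp Require Import generic_quotient fraction complex.
From mathcomp Require Import all_classical all_reals all_analysis.

Set Implicit Arguments.
Unset Strict Implicit.
Unset Printing Implicit Defensive.

Import Order.TTheory GRing.Theory Num.Theory.
Import numFieldNormedType.Exports.

Local Open Scope classical_set_scope.
Local Open Scope ring_scope.

(* Since R'(x) x' = 1 along a root of R(x) = q, it suffices to invert R'(x)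
   modulo R(x) - q by a polynomial in x of degree at most n - 1 over the
   rational functions of q. The powers of R are linearly dependent modulo R',
   so some c <> 0 satisfies c(R(x)) = s(x) R'(x), and R - q divides
   c(R(x)) - c(q); hence s / c(q), reduced modulo R - q, is an inverse. At a q
   where c vanishes but no coefficient has a pole, the identity persists
   because the leading coefficient of R - q in x is a constant, so that c can
   be cancelled without losing divisibility over polynomials in q. *)

Lemma dvdp_comp_poly_neq0 (F : fieldType) (p d : {poly F}) :
  d != 0 -> exists2 c : {poly F}, c != 0 & d %| c \Po p.
Proof.
move=> d0; pose n := size d.
have n_gt0 : (0 < n)%N by rewrite size_poly_gt0.
(* The [n] remainders have at most [n - 1] coefficients each, so the rows of [M] are dependent; a
   nonzero kernel row lists the coefficients of [c]. *)
pose M : 'M[F]_(n, n.-1) := \matrix_i poly_rV (p ^+ i %% d).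
have /rowV0Pn[u /sub_kermxP uM u0] : kermx M != 0.
  rewrite kermx_eq0 /row_free neq_ltn (leq_ltn_trans (rank_leq_col _)) //.
  by rewrite prednK.
exists (rVpoly u).
  by apply: contraNneq u0 => u0; rewrite -[u]rVpolyK u0 raddf0.
apply/modp_eq0P.
have -> : (rVpoly u \Po p) %% d = \sum_(i < n) u 0 i *: (p ^+ i %% d).
  rewrite /comp_poly (@horner_coef_wide _ n) ?size_map_polyC ?size_poly //.
  rewrite (big_morph (fun r => r %% d) (modpD d) (mod0p d)).
  by apply: eq_bigr => i _; rewrite coef_map mul_polyC modpZl coef_rVpoly_ord.
set s := \sum_i _; suff s0 : poly_rV s = 0 :> 'rV_n.-1.
  rewrite -(@poly_rV_K _ n.-1 s) ?s0 ?raddf0 //.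
  apply: (leq_trans (size_sum _ _ _)); apply/bigmax_leqP => i _.
  by rewrite (leq_trans (size_scale_leq _ _))// -ltnS prednK// ltn_modp.
rewrite -uM mulmx_sum_row raddf_sum; apply: eq_bigr => i _.
by rewrite rowK/= linearZ.
Qed.

Lemma horner_sub_factor (A : nzRingType) (p : {poly A}) (b : A) :
  exists g : {poly A}, p - p.[b]%:P = g * ('X - b%:P).
Proof. by apply/factor_theorem; rewrite /root !hornerE subrr. Qed.

(** Cancelling the gcd does not change the fraction; the cross-multiplied form is an identity of
    polynomials, usable at the zeros of [c] too. *)
Lemma ratfun_Ratio (F : fieldType) (p c : {poly F}) (c0 : c != 0) :
  let f := \pi_{fraction {poly F}}%qT (Ratio p c) in
  c * ratfun_num f = p * ratfun_den f.
Proof.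
rewrite /ratfun_num /ratfun_den.
have := FracField.equivf_r (Ratio p c); rewrite !numden_Ratio //=.
set r := repr _ => /eqP; set g := gcdp _ _ => e.
have g0 : g != 0 by rewrite gcdp_eq0 negb_and denom_ratioP orbT.
apply: (mulIf g0); rewrite -!mulrA !divpK ?dvdp_gcdl ?dvdp_gcdr //.
exact/esym/eqP.
Qed.

Lemma cvg_horner (K : numFieldType) (T : Type) (F : set_system T)
    {FF : Filter F} (p : {poly K}) (f : T -> K^o) (a : K^o) :
  f @ F --> a -> (p.[f t] : K^o) @[t --> F] --> (p.[a] : K^o).
Proof.
move=> fa; elim/poly_ind: p => [|p c ih].
  under eq_fun do rewrite horner0.
  by rewrite horner0; exact: cvg_cst.
under eq_fun do rewrite hornerMXaddC.
rewrite hornerMXaddC.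
by apply: cvgD; [exact: cvgM|exact: cvg_cst].
Qed.

(** Over the complex numbers, [P - P(x(q)) = g * ('X - x(q))] yields
    [g(x(q+h)) * (x(q+h) - x(q)) = h]. Divide by [h] and let [h] tend to 0, using
    [g(x(q)) = P'(x(q))]. *)
Lemma root_branch_deriv (R : realType) (P : {poly R}) (U : set R)
    (x : R -> (complex R)^o) (q : R) (l : (complex R)^o) :
  root_branch P U x -> U q -> is_cderive1 x q l ->
  (map_poly (real_complex R) P^`()).[x q] * l = 1.
Proof.
move=> [oU _ cx rx] Uq xl; rewrite -deriv_map.
set p := map_poly _ P in rx *.
have [g pg] := horner_sub_factor p (x q).
have -> : p^`().[x q] = g.[x q].
  have := congr1 (fun r => r^`().[x q]) pg.
  by rewrite /= !poly.derivE subr0 !hornerE subrr mulr0 add0r.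
have q_cvg : q + h @[h --> 0^'] --> q.
  apply: cvg_within_filter.
  rewrite -[in X in _ --> X](addr0 q).
  by apply: cvgD; [exact: cvg_cst|exact: cvg_id].
have x_cvg : x (q + h) @[h --> 0^'] --> x q.
  by apply: (cvg_comp _ _ q_cvg); apply: cx; rewrite inE.
have gx : g.[x (q + h)] * ((x (q + h) - x q) / h%:C%C) @[h --> 0^']
    --> (g.[x q] * l : (complex R)^o).
  by apply: cvgM xl; exact: cvg_horner.
apply: (@norm_cvg_unique _ (complex R)^o _ _ _ _ gx); apply: cvg_near_cst.
near=> h.
have h0 : h != 0 by near: h; exact: nbhs_dnbhs_neq.
have Uqh : U (q + h) by near: h; apply: q_cvg; exact: open_nbhs_nbhs.
have := congr1 (fun r => r.[x (q + h)]) pg.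
rewrite /= !hornerE !rx// rmorphD /= addrC addKr => hE.
by rewrite -hE divff// fmorph_eq0.
Unshelve. all: by end_near.
Qed.

(** Modulo [p(x) - q], each [p(x)] may be replaced by [q]; the induction follows Horner's scheme for
    [c]. *)
Lemma dvdp_comp_poly_sub (F : fieldType) (p c : {poly F}) :
  p^:P - 'X%:P %| (c \Po p)^:P - c%:P.
Proof.
elim/poly_ind: c => [|c k ih]; first by rewrite comp_poly0 raddf0 polyC0 subr0.
rewrite comp_poly_MXaddC !rmorphD !rmorphM /= map_polyC /=.
set C := (c \Po p)^:P in ih *.
have -> : C * p^:P + k%:P%:P - (c%:P * 'X%:P + k%:P%:P) =
    (C - c%:P) * p^:P + c%:P * (p^:P - 'X%:P).
  by rewrite mulrBl mulrBr addrA subrK opprD addrACA subrr addr0.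
by apply: dvdp_add; [exact: dvdp_mulr|exact: dvdp_mull].
Qed.

(** The morphism [f] allows real coefficients together with a complex root [z]. *)
Lemma ratfun_inverse_deriv (F : fieldType) (m : nat) (P : {poly F}) :
  size P = m.+2 -> P^`() != 0 ->
  exists a : 'I_m.+1 -> {fraction {poly F}},
    forall (A : comNzRingType) (f : {rmorphism F -> A}) (q : F) (z : A),
      (forall j, ~~ has_pole (a j) q) -> (map_poly f P).[z] = f q ->
      (\sum_j f (ratfun_eval (a j) q) * z ^+ j) * (map_poly f P^`()).[z] = 1.
Proof.
move=> sP P'0; have [c c0 /dvdpP[s cs]] := dvdp_comp_poly_neq0 P P'0.
(* Outer variable x, inner variable q. *)
pose Q : {poly {poly F}} := P^:P - 'X%:P.
have sX : (size (- ('X : {poly F})%:P) < size P^:P)%N.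
  by rewrite size_map_polyC sP size_polyN (leq_ltn_trans (size_polyC_leq1 _)).
have sQ : size Q = m.+2 by rewrite size_polyDl// size_map_polyC.
(* Subtracting [q] only alters the term of degree 0 in [x], so the leading coefficient is that of
   [P]. *)
have uQ : lead_coef Q \is a GRing.unit.
  rewrite lead_coefDl// lead_coef_map poly_unitE size_polyC lead_coef_eq0.
  rewrite coefC eqxx unitfE lead_coef_eq0 -size_poly_eq0 sP //.
pose r := s^:P %% Q.
have sr : (size r <= m.+1)%N by rewrite -ltnS -sQ ltn_modp -size_poly_eq0 sQ.
have Qr : Q %| r * P^`()^:P - c%:P.
  have := dvdp_comp_poly_sub P c; rewrite cs rmorphM/= -/Q.
  rewrite [s^:P](Pdiv.IdomainUnit.divp_eq uQ) mulrDl -addrA -/r.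
  rewrite dvdp_addr//; apply: dvdp_mulr; exact: dvdp_mull.
pose a (j : 'I_m.+1) := \pi_{fraction {poly F}}%qT (Ratio r`_j c).
exists a => A f q z npole zq.
(* [B / D] is [r / c] written over the reduced denominators: without poles [D] is nonzero at [q],
   even if [c] vanishes there. *)
pose D := \prod_j ratfun_den (a j).
pose t j := ratfun_num (a j) * \prod_(i | i != j) ratfun_den (a i).
pose B : {poly {poly F}} := \sum_j t j *: 'X^j.
have cB : c *: B = D *: r.
  have -> : r = \poly_(j < m.+1) r`_j.
    apply/polyP => i; rewrite coef_poly; case: ltnP => // mi.
    by rewrite nth_default// (leq_trans sr).
  rewrite poly_def !scaler_sumr; apply: eq_bigr => j _.
  rewrite !scalerA; congr (_ *: _).
  by rewrite mulrA ratfun_Ratio// -mulrA mulrC /D [in RHS](bigD1 j).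
(* [%|] over {poly F} is only pseudo-divisibility, hence insensitive to the
   factor c; it is true divisibility since the leading coefficient of Q is a
   unit. *)
have /(Pdiv.IdomainUnit.dvdpP uQ)[e eB] : Q %| B * P^`()^:P - D%:P.
  rewrite -(dvdpZr _ _ c0).
  have -> : c *: (B * P^`()^:P - D%:P) = D *: (r * P^`()^:P - c%:P).
    by rewrite !scalerBr !scalerAl cB -!mul_polyC -!rmorphM/= [c * D]mulrC.
  by rewrite -mul_polyC dvdp_mull.
(* Specializing the inner variable to [q] and the outer one to [z] kills [Q]. *)
pose ev := f \o horner_eval q.
have ev_lift (p : {poly F}) : map_poly ev p^:P = map_poly f p.
  rewrite -map_poly_comp; apply: eq_map_poly => k.
  by rewrite /ev/= /horner_eval hornerC.
have evQ : (map_poly ev Q).[z] = 0.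
  rewrite rmorphB/= ev_lift map_polyC !hornerE zq.
  by rewrite /ev/= /horner_eval hornerX subrr.
have fD : f D.[q] * f D.[q]^-1 = 1.
  rewrite -rmorphM divff ?rmorph1// horner_prod.
  by apply/prodf_neq0 => j _; exact: npole.
have tE j : (t j).[q] = D.[q] * ratfun_eval (a j) q.
  rewrite /t /D [in RHS](bigD1 j)//= !hornerM /ratfun_eval.
  by rewrite [RHS]mulrAC [_ * (_ / _)]mulrC divfK//; exact: npole.
have := congr1 (fun p => (map_poly ev p).[z]) eB.
rewrite rmorphB !rmorphM/= ev_lift map_polyC hornerD hornerN !hornerM evQ mulr0.
rewrite hornerC => /subr0_eq.
have -> : (map_poly ev B).[z] =
    f D.[q] * \sum_j f (ratfun_eval (a j) q) * z ^+ j.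
  rewrite rmorph_sum horner_sum mulr_sumr; apply: eq_bigr => j _.
  rewrite /= map_polyZ map_polyXn hornerZ hornerXn.
  by rewrite /ev/= /horner_eval tE rmorphM mulrA.
rewrite /ev /= /horner_eval => /(congr1 (fun y => f D.[q]^-1 * y)).
by rewrite !mulrA [_ * f D.[q]]mulrC fD mul1r.
Qed.

Theorem theorem1p3 (R : realType) (n : nat) (P : {poly R})
    (hn : (2 <= n)%N) (hP : size P = n.+1) (hP0 : P.[0] = 0) :
  exists a : 'I_n.-1.+1 -> {fraction {poly R}},
    forall (U : set R) (x : R -> (complex R)^o),
      root_branch P U x ->
      x q @[q --> (0 : R)] --> (0 : (complex R)^o) ->
      satisfies_Abel_ODE a U x.
Proof.
case: n hn hP => [//|m] _ hP.
(* In characteristic 0, the coefficient of degree [m], which is [m + 1] times the leading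
   coefficient of [P], is nonzero. *)
have P'0 : P^`() != 0.
  apply/eqP => /(congr1 (fun p : {poly R} => p`_m)); rewrite coef_deriv coef0.
  move/eqP; rewrite mulrn_eq0/= -[m.+1]/(m.+2.-1) -hP -lead_coefE lead_coef_eq0.
  by rewrite -size_poly_eq0 hP.
have [a aP] := ratfun_inverse_deriv hP P'0.
exists a => U x Px _ q l Uq npole xl.
have [_ _ _ rx] := Px.
have := aP _ (real_complex R) q (x q) npole (rx q Uq).
set y := \sum_j _ => yP.
by rewrite -[l]mul1r -yP -mulrA (root_branch_deriv Px Uq xl) mulr1.
Qed.
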